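(* Let $K$ be the algebraic closure of a finite field $\mathbb{F}_q$ of characteristic $p$. Let $\alpha_1,\dots,\alpha_r\in K$ be pairwise distinct, let $m$ be a positive integer with $p\nmid m$, let $\lambda_1,\dots,\lambda_r$ be integers with $1\le\lambda_i<m$, set $\lambda_0:=\sum_{i=1}^r\lambda_i$ and suppose $\gcd(m,\lambda_0)=1$. Let $\mathcal{F}=K(x,y)$ be the function field of the curve $y^m=\prod_{i=1}^r(x-\alpha_i)^{\lambda_i}$, and let $Q_\infty$ be the only place of $\mathcal{F}$ over the pole of $x$ in $K(x)$. Then the gap set at $Q_\infty$ is $$G(Q_\infty)=\left\{mj-i\lambda_0\ \middle|\ 1\le i\le m-1,\ \left\lceil\frac{i\lambda_0}{m}\right\rceil\le j\le\sum_{\ell=1}^r\left\lceil\frac{i\lambda_\ell}{m}\right\rceil-1\right\},$$ where $i,j$ range over integers.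
   Context: $\mathbb{N}=\{0,1,2,\dots\}$. For a place $P$ of the function field $\mathcal{F}/K$, the Weierstrass semigroup is $H(P)=\{s\in\mathbb{N}\mid (z)_\infty=sP\text{ for some }z\in\mathcal{F}\}$, where $(z)_\infty$ is the pole divisor of $z$, and the gap set is $G(P)=\mathbb{N}\setminus H(P)$. $\lceil\cdot\rceil$ is the ceiling function. *)

(* Defs.v *)
From HB Require Import structures.
From mathcomp Require Import all_boot all_order all_algebra all_field.
From mathcomp Require Import boolp classical_sets.

Set Implicit Arguments.
Unset Strict Implicit.
Unset Printing Implicit Defensive.

Import Order.TTheory GRing.Theory Num.Theory.

Local Open Scope classical_set_scope.
Local Open Scope ring_scope.

Section Places.
Variables (K F : fieldType) (iota : {rmorphism K -> F}).

Definition is_valuation_ring (O : set F) : Prop :=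
  [/\ GRing.subring_closed [in O],
      range iota `<` O,
      O `<` [set: F]
    & forall z : F, O z \/ O z^-1].

(* A place P is the maximal ideal of a valuation ring O_P of F/K.  Since P and
   O_P determine each other, a place is stored as O_P; its maximal ideal is
   [place_ideal] below. *)
Record place := Place {
  place_ring : set F;
  place_ringP : is_valuation_ring place_ring
}.

Definition place_unit (P : place) : set F :=
  [set z | [/\ z != 0, place_ring P z & place_ring P z^-1]].

Definition place_ideal (P : place) : set F := place_ring P `\` place_unit P.

Definition prime_element (P : place) (t : F) : Prop :=
  place_ideal P = [set t * a | a in place_ring P].

(* [has_valuation P z n] is v_P(z) = n, for z != 0: z = t ^ n * u with t a
   prime element of P and u a unit of O_P. *)
Definition has_valuation (P : place) (z : F) (n : int) : Prop :=
  exists t u : F, [/\ prime_element P t, place_unit P u & z = t ^ n * u].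

(* P is a pole of z when v_P(z) < 0, i.e., when z is not in O_P. *)
Definition is_pole (P : place) (z : F) : Prop := ~ place_ring P z.

(* A divisor is given by its coefficients. [is_pole_divisor z D] says that D is
   (z)_oo = \sum_(P pole of z) - v_P(z) P. *)
Definition is_pole_divisor (z : F) (D : place -> int) : Prop :=
  z != 0 /\
  forall P : place, (is_pole P z -> has_valuation P z (- D P)) /\
                    (~ is_pole P z -> D P = 0).

Definition place_multiple (s : nat) (P : place) : place -> int :=
  fun P' => if `[< P' = P >] then s%:Z else 0.

Definition weierstrass_semigroup (P : place) : set nat :=
  [set s | exists z : F, is_pole_divisor z (place_multiple s P)].

Definition gap_set (P : place) : set nat := ~` weierstrass_semigroup P.

End Places.

(* Q lies over P: the maximal ideal of P is mapped by f into that of Q. *)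
Definition lies_over (K E F : fieldType) (iE : {rmorphism K -> E})
    (iF : {rmorphism K -> F}) (f : {rmorphism E -> F})
    (Q : place iF) (P : place iE) : Prop :=
  f @` place_ideal P `<=` place_ideal Q.

Definition ratfun_const (K : fieldType) :
    {rmorphism K -> {fraction {poly K}}} :=
  @FracField.tofrac {poly K} \o polyC.

Definition ratfun_X (K : fieldType) : {fraction {poly K}} :=
  FracField.tofrac 'X.

Definition ratfun_ext (K : fieldType) (F : fieldExtType {fraction {poly K}}) :
    {rmorphism {fraction {poly K}} -> F} :=
  in_alg F.

Definition ext_const (K : fieldType) (F : fieldExtType {fraction {poly K}}) :
    {rmorphism K -> F} :=
  ratfun_ext F \o ratfun_const K.

Definition ceil_div (a b : int) : int := Num.ceil (a%:~R / b%:~R : rat).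

(* Main.v *)
Require Import Defs.
From HB Require Import structures.
From mathcomp Require Import all_boot all_order all_algebra all_field.
From mathcomp Require Import boolp classical_sets.
From mathcomp Require Import ring zify.

Set Implicit Arguments.
Unset Strict Implicit.
Unset Printing Implicit Defensive.

(** Write [f] for the product of the [('X - alpha l) ^ lambda l], so that
    [y ^ m = f(x)], write [lambda0] for its degree, and let [w = y^-1].

    At a place where [x] has a pole every polynomial in [x] is dominated by its
    leading term, so [y ^ m] behaves like [x ^ lambda0].  As [m] and [lambda0]
    are coprime, some monomial [t] in [x] and [y] has a power [t ^ m] that
    behaves like [x^-1]; in units of [t], [x] has order [- m] and [w] has order
    [lambda0].  Each element of the function field is a sum of terms
    [c_i(x) w ^ i] with [0 <= i < m].  The orders [lambda0 * i - m * deg c_i] of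
    these terms are pairwise incongruent modulo [m], so exactly one term
    dominates ([expansion_order]).  Hence every nonzero element has an integral
    order, which depends on its coefficients and not on the place: [t] is a
    prime element, the place over the pole of [x] is unique
    ([infinite_place_unique]), and the powers [w ^ i] are independent over the
    rational functions.

    An element whose only pole is this place lies in the valuation ring of every
    place where [x] is finite.  The automorphisms [w |-> zeta w], for the [m]-th
    roots of unity [zeta], permute these places, and averaging over them
    isolates each term [c_i w ^ i], which is therefore finite at all of these
    places as well ([component_integral]).  Its [m]-th power is the rational
    function [c_i ^ m / f ^ i].  Since there is a place over each point of the
    affine line ([place_over], by Chevalley's theorem [place_extension]),
    [c_i] is a polynomial divisible by the product of the
    [('X - alpha l) ^ ceil (i * lambda l / m)] ([component_poly]).

    So the pole orders are exactly the numbers [s = m * j - i * lambda0] with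
    [0 <= i < m] and [j] at least the sum of the [ceil (i * lambda l / m)]: a
    pole order is the order of a dominant term, whence the necessity
    ([pole_order_shape]), and the minimal admissible [c_i] times a power of [x]
    realizes every such number ([pole_order_of_shape]).  The gaps are the natural
    numbers of the same form with [j] below that sum.  For [i = 0] the bound is
    [0], which is why [i] starts at [1]. *)

Import Order.TTheory GRing.Theory Num.Theory.

Local Open Scope classical_set_scope.
Local Open Scope ring_scope.

(** * Places and orders *)

Section PlaceTheory.
Variables (K F : fieldType) (iota : {rmorphism K -> F}).
Implicit Types (P Q : place iota) (u v z t : F).

Lemma place_subring P : GRing.subring_closed [in place_ring P].
Proof. by case: P => O []. Qed.

Lemma place_ring1 P : place_ring P 1.
Proof. by have [+ _ _] := place_subring P; rewrite inE. Qed.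

Lemma place_ringB P u v : place_ring P u -> place_ring P v -> place_ring P (u - v).
Proof. by have [_ + _] := place_subring P => /(_ u v); rewrite !inE. Qed.

Lemma place_ringM P u v : place_ring P u -> place_ring P v -> place_ring P (u * v).
Proof. by have [_ _ +] := place_subring P => /(_ u v); rewrite !inE. Qed.

Lemma place_ring0 P : place_ring P 0.
Proof. by rewrite -(subrr 1); apply: place_ringB; apply: place_ring1. Qed.

Lemma place_ringN P u : place_ring P u -> place_ring P (- u).
Proof. by rewrite -sub0r; apply: place_ringB; apply: place_ring0. Qed.

Lemma place_ringD P u v : place_ring P u -> place_ring P v -> place_ring P (u + v).
Proof. by move=> Pu /place_ringN; rewrite -{2}[v]opprK; apply: place_ringB. Qed.

Lemma place_ringX P u n : place_ring P u -> place_ring P (u ^+ n).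
Proof.
move=> Pu; elim: n => [|n IHn]; first exact: place_ring1.
by rewrite exprS; apply: place_ringM.
Qed.

Lemma place_ring_const P a : place_ring P (iota a).
Proof. by case: P => O [] /= _ [+ _] _ _; apply; exists a. Qed.

Lemma place_ringVor P z : place_ring P z \/ place_ring P z^-1.
Proof. by case: P => O [] /= _ _ _ /(_ z). Qed.

Lemma place_ring_sum P (I : Type) (s : seq I) (R : pred I) (E : I -> F) :
  (forall i, R i -> place_ring P (E i)) -> place_ring P (\sum_(i <- s | R i) E i).
Proof.
by move=> PE; apply: big_ind => //; [apply: place_ring0 | apply: place_ringD].
Qed.

(** The second field of the record is a proof, hence irrelevant. *)
Lemma place_inj P Q : place_ring P = place_ring Q -> P = Q.
Proof.
case: P Q => [O1 h1] [O2 h2] /= eO; case: _ / eO h2 => h2.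
by rewrite (Prop_irrelevance h1 h2).
Qed.

(** If [z^-1] lies in the ring then so does
    [z = z ^ n * (z^-1) ^ (n - 1)]. *)
Lemma place_ring_root P z n : (0 < n)%N -> place_ring P (z ^+ n) -> place_ring P z.
Proof.
case: n => // n _ Pzn; have [//|PzV] := place_ringVor P z.
have [->|z0] := eqVneq z 0; first exact: place_ring0.
suff -> : z = z ^+ n.+1 * z^-1 ^+ n by apply: place_ringM => //; apply: place_ringX.
by rewrite exprVn exprS mulfK // expf_neq0.
Qed.

Lemma place_unit1 P : place_unit P 1.
Proof. by split; rewrite ?invr1 ?oner_neq0 //; apply: place_ring1. Qed.

Lemma place_unitM P u v : place_unit P u -> place_unit P v -> place_unit P (u * v).
Proof.
move=> [u0 Pu PuV] [v0 Pv PvV].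
by split; rewrite ?mulf_neq0 ?invfM //; apply: place_ringM.
Qed.

Lemma place_unitV P u : place_unit P u -> place_unit P u^-1.
Proof. by move=> [u0 Pu PuV]; split; rewrite ?invr_eq0 ?invrK. Qed.

Lemma place_unitX P u n : place_unit P u -> place_unit P (u ^+ n).
Proof.
move=> Uu; elim: n => [|n IHn]; first exact: place_unit1.
by rewrite exprS; apply: place_unitM.
Qed.

Lemma place_unitXz P u (n : int) : place_unit P u -> place_unit P (u ^ n).
Proof.
move=> Uu; case: n => n; first exact: place_unitX.
by rewrite NegzE -exprnN; apply/place_unitV/place_unitX.
Qed.

Lemma place_unit_root P z n : (0 < n)%N -> place_unit P (z ^+ n) -> place_unit P z.
Proof.
move=> n0 [zn0 Pzn PzVn]; split; first by move: zn0; rewrite expf_eq0 n0.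
  exact: place_ring_root Pzn.
by apply: (place_ring_root n0); rewrite exprVn.
Qed.

Lemma place_unit_const P a : a != 0 -> place_unit P (iota a).
Proof.
move=> a0; split; first by rewrite fmorph_eq0.
  exact: place_ring_const.
by rewrite -fmorphV; apply: place_ring_const.
Qed.

Lemma place_idealP P z : place_ideal P z <-> z = 0 \/ ~ place_ring P z^-1.
Proof.
split=> [[Pz nU]|[->|nPzV]].
- have [->|z0] := eqVneq z 0; [by left|right=> PzV].
  exact: nU.
- by split; [apply: place_ring0|case; rewrite eqxx].
have [Pz|//] := place_ringVor P z.
by split=> // -[].
Qed.

Lemma place_ideal_ring P z : place_ideal P z -> place_ring P z.
Proof. by case. Qed.

Lemma place_ideal0 P : place_ideal P 0.
Proof. by apply/place_idealP; left. Qed.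

Lemma place_idealM P z v : place_ideal P z -> place_ring P v -> place_ideal P (z * v).
Proof.
move=> [Pz nU] Pv; split; first exact: place_ringM.
move=> [zv0 _ PzvV]; apply: nU; have := zv0; rewrite mulf_eq0 => /norP[z0 v0].
split=> //; suff -> : z^-1 = v * (z * v)^-1 by apply: place_ringM.
by rewrite invfM mulrCA mulfV // mulr1.
Qed.

(** Of two elements one divides the other in the valuation ring, and the sum is
    then a multiple of the divisor. *)
Lemma place_idealD P u v : place_ideal P u -> place_ideal P v -> place_ideal P (u + v).
Proof.
wlog Puv : u v / place_ring P (u / v).
  move=> wl iu iv; have [Puv|] := place_ringVor P (u / v); first exact: wl.
  by rewrite invfM invrK mulrC => Pvu; rewrite addrC; apply: wl.
move=> iu iv; have [->|v0] := eqVneq v 0; first by rewrite addr0.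
suff -> : u + v = v * (u / v + 1).
  by apply: place_idealM => //; apply: place_ringD => //; apply: place_ring1.
by rewrite mulrDr mulr1 mulrCA mulfV // mulr1.
Qed.

Lemma place_ideal_sum P (I : Type) (s : seq I) (R : pred I) (E : I -> F) :
  (forall i, R i -> place_ideal P (E i)) -> place_ideal P (\sum_(i <- s | R i) E i).
Proof.
by move=> PE; apply: big_ind => //; [apply: place_ideal0 | apply: place_idealD].
Qed.

Lemma place_unitD_ideal P u z : place_unit P u -> place_ideal P z -> place_unit P (u + z).
Proof.
move=> Uu iz; apply: contrapT => nU.
have iuz : place_ideal P (u + z).
  by split=> //; apply: place_ringD; [case: Uu|case: iz].
suff [] : place_ideal P u by [].
have -> : u = (u + z) + z * - 1 by rewrite mulrN1 addrK.
by apply: place_idealD => //; apply: place_idealM => //; apply/place_ringN/place_ring1.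
Qed.

Lemma place_unit_not_ideal P u : place_unit P u -> ~ place_ideal P u.
Proof. by move=> Uu []. Qed.

(** Orders are measured in units of any [t], not only of a prime element, since
    they are first obtained in units of [x]. *)
Definition has_order P t z (e : int) : Prop := place_unit P (z * t ^ (- e)).

Section Order.
Variables (P : place iota) (t : F).
Hypotheses (it : place_ideal P t) (t0 : t != 0).

Lemma ideal_expz (e : int) : 0 < e -> place_ideal P (t ^ e).
Proof.
case: e => [[|n]|n] // _; rewrite -exprnP exprS.
by apply: place_idealM => //; apply/place_ringX/place_ideal_ring.
Qed.

Lemma ring_expz (e : int) : 0 <= e -> place_ring P (t ^ e).
Proof.
by case: e => [n|n] // _; rewrite -exprnP; apply/place_ringX/place_ideal_ring.
Qed.

Lemma unit_expz (e : int) : place_unit P (t ^ e) -> e = 0.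
Proof.
move=> Ute; case: (ltrgtP e 0) => // e0.
  have /place_unitV := Ute; rewrite invr_expz => /place_unit_not_ideal[].
  by apply: ideal_expz; rewrite oppr_gt0.
by have /place_unit_not_ideal[] := Ute; apply: ideal_expz.
Qed.

Lemma order_unit u : place_unit P u -> has_order P t u 0.
Proof. by rewrite /has_order oppr0 expr0z mulr1. Qed.

Lemma orderM z z' (e e' : int) :
  has_order P t z e -> has_order P t z' e' -> has_order P t (z * z') (e + e').
Proof.
by move=> U U'; rewrite /has_order opprD expfzDr // mulrACA; apply: place_unitM.
Qed.

Lemma orderXz z (e n : int) : has_order P t z e -> has_order P t (z ^ n) (e * n).
Proof.
by move=> U; rewrite /has_order -mulNr -exprz_exp -expfzMl; apply: place_unitXz.
Qed.

Lemma order_root z (e : int) n :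
  (0 < n)%N -> has_order P t (z ^+ n) (e * n%:Z) -> has_order P t z e.
Proof.
move=> n0; rewrite /has_order -mulNr -exprz_exp -[_ ^ n%:Z]exprnP -exprMn.
exact: place_unit_root.
Qed.

(** Orders multiply under a change of unit. *)
Lemma order_trans s z (a e : int) :
  has_order P t s a -> has_order P s z e -> has_order P t z (a * e).
Proof.
move=> Us Uz; have [s0 _ _] := Us.
have {}s0 : s != 0 by move: s0; rewrite mulf_eq0 => /norP[].
have := orderM (orderXz e Us) (order_unit Uz); rewrite addr0 mulrCA -expfzDr //.
by rewrite subrr expr0z mulr1.
Qed.

Lemma order_uniq z (e e' : int) :
  has_order P t z e -> has_order P t z e' -> e = e'.
Proof.
move=> U1 U2; apply/eqP; rewrite -subr_eq0; apply/eqP/unit_expz.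
have [z0 _ _] := U1; have := place_unitM U2 (place_unitV U1).
rewrite invfM invr_expz opprK mulrACA mulfV ?mul1r; last first.
  by move: z0; rewrite mulf_eq0 => /norP[].
by rewrite -expfzDr // addrC.
Qed.

Lemma order_ring z (e : int) :
  has_order P t z e -> place_ring P z <-> 0 <= e.
Proof.
move=> Uz; have zE : z = z * t ^ (- e) * t ^ e.
  by rewrite -mulrA -expfzDr // addNr expr0z mulr1.
split=> [Pz|e0]; last first.
  by rewrite zE; apply: place_ringM; [case: Uz | apply: ring_expz].
rewrite leNgt; apply/negP => e0.
have : place_ideal P (z * t ^ (- e)).
  by rewrite mulrC; apply: place_idealM => //; apply: ideal_expz; rewrite oppr_gt0.
exact: place_unit_not_ideal.
Qed.

(** A term of order smaller than all the others dominates the sum: divided by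
    the corresponding power of [t], it is a unit and the other terms are not. *)
Lemma order_min (I : finType) (E : I -> F) (e : I -> int) (i0 : I) :
    has_order P t (E i0) (e i0) ->
    (forall i, i != i0 ->
       E i = 0 \/ has_order P t (E i) (e i) /\ e i0 < e i) ->
  has_order P t (\sum_i E i) (e i0).
Proof.
move=> U0 Ui; rewrite /has_order mulr_suml (bigD1 i0) //=; apply: place_unitD_ideal => //.
apply: place_ideal_sum => i /Ui[->|[U lt_e]]; first by rewrite mul0r; apply: place_ideal0.
suff -> : E i * t ^ (- e i0) = t ^ (e i - e i0) * (E i * t ^ (- e i)).
  by apply: place_idealM; [apply: ideal_expz; rewrite subr_gt0 | case: U].
by rewrite mulrCA -expfzDr // addrAC subrr add0r.
Qed.

(** When orders in units of [t] are integers, a nonunit has order at least [1],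
    so that [t] divides it. *)
Lemma prime_of_order :
  (forall z, z != 0 -> exists e : int, has_order P t z e) ->
  prime_element P t.
Proof.
move=> ord; apply/seteqP; split=> [z iz|_ [a Pa <-]]; last exact: place_idealM.
have [->|z0] := eqVneq z 0; first by exists 0; rewrite ?mulr0 //; apply: place_ring0.
exists (t^-1 * z); last by rewrite mulrA mulfV // mul1r.
have [e Ue] := ord z z0.
have e1 : 1 <= e.
  rewrite -gtz0_ge1 lt_neqAle; have /(order_ring Ue) -> := place_ideal_ring iz.
  rewrite andbT; apply/eqP => e0; move: Ue; rewrite /has_order -e0 oppr0 expr0z mulr1.
  by move=> /place_unit_not_ideal.
suff U : has_order P t (t^-1 * z) (e - 1).
  by apply/(order_ring U); rewrite subr_ge0.
rewrite /has_order; suff -> : t^-1 * z * t ^ (- (e - 1)) = z * t ^ (- e) by [].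
by rewrite opprB expfzDr // expr1z mulrAC [t^-1 * _]mulrA mulVf // mul1r mulrC.
Qed.

(** Two prime elements differ by a unit, so the prime element in the definition
    of a valuation may be taken to be [t]. *)
Lemma prime_order_valuation z (n e : int) :
    prime_element P t -> has_order P t z e ->
  has_valuation P z n <-> n = e.
Proof.
move=> pt Uz; split=> [[t' [u [pt' Uu zE]]]|->]; last first.
  exists t, (z * t ^ (- e)); split=> //.
  by rewrite mulrCA -expfzDr // subrr expr0z mulr1.
have it' : place_ideal P t' by rewrite pt'; exists 1; rewrite ?mulr1 //; apply: place_ring1.
have [a Pa t'E] : [set t * a | a in place_ring P] t' by rewrite -pt.
have [b Pb tE] : [set t' * a | a in place_ring P] t by rewrite -pt'.
have t'0 : t' != 0 by apply: contraNneq t0 => t'0; rewrite -tE t'0 mul0r.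
have Ua : place_unit P a.
  have a0 : a != 0 by apply: contraNneq t'0 => a0; rewrite -t'E a0 mulr0.
  split=> //; suff -> : a^-1 = b by [].
  apply: (mulfI t'0); rewrite tE; apply: (mulIf a0).
  by rewrite -mulrA mulVf // mulr1.
apply: (@order_uniq z) => //; rewrite /has_order zE -t'E expfzMl.
have -> : t ^ n * a ^ n * u * t ^ (- n) = a ^ n * u * (t ^ n * t ^ (- n)).
  by rewrite -!mulrA mulrCA; congr (_ * _); rewrite mulrC -mulrA [t ^ (- n) * _]mulrC.
rewrite -expfzDr // subrr expr0z mulr1.
by apply: place_unitM => //; apply: place_unitXz.
Qed.

End Order.
End PlaceTheory.

Arguments order_min {K F iota P t} it t0 {I} E e {i0}.

(** * Extension of places *)

Section Chevalley.
Variables (K F : fieldType) (iota : {rmorphism K -> F}).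
Implicit Types (R : set F) (t z u v : F) (p q : {poly F}).

Section MaximalSubring.
Variables (R : set F) (t : F).
Hypotheses (subR : GRing.subring_closed [in R]) (Rt : R t) (tVR : ~ R t^-1).
Hypothesis maxR : forall S : set F,
  GRing.subring_closed [in S] -> R `<` S -> S t^-1.

Let R1 : R 1. Proof. by case: subR => + _ _; rewrite inE. Qed.

Let RB u v : R u -> R v -> R (u - v).
Proof. by case: subR => _ + _ => /(_ u v); rewrite !inE. Qed.

Let RM u v : R u -> R v -> R (u * v).
Proof. by case: subR => _ _ + => /(_ u v); rewrite !inE. Qed.

Let R0 : R 0. Proof. by rewrite -(subrr 1); apply: RB. Qed.

Let RN u : R u -> R (- u). Proof. by rewrite -sub0r; apply: RB. Qed.

Let RD u v : R u -> R v -> R (u + v).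
Proof. by move=> Ru /RN; rewrite -{2}[v]opprK; apply: RB. Qed.

Let RX u n : R u -> R (u ^+ n).
Proof. by move=> Ru; elim: n => [|n IHn] //; rewrite exprS; apply: RM. Qed.

Let Rsum (I : Type) (s : seq I) (Q : pred I) (E : I -> F) :
  (forall i, Q i -> R (E i)) -> R (\sum_(i <- s | Q i) E i).
Proof. by move=> RE; apply: big_ind. Qed.

Let t0 : t != 0. Proof. by apply/eqP => t0; apply: tVR; rewrite t0 invr0. Qed.

(** Adjoining to [R] an element outside [R] must produce the forbidden
    inverse [t^-1]; multiplied by [t] this writes [1] as a polynomial
    expression with coefficients in [t R]. *)
Lemma adjoin_inverse z : ~ R z ->
  exists2 p : {poly F}, forall i, exists2 a, R a & p`_i = t * a & p.[z] = 1.
Proof.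
move=> nRz; pose S := [set w | exists2 p : {poly F}, (forall i, R p`_i) & w = p.[z]].
have subS : GRing.subring_closed [in S].
  split=> [|u v|u v]; rewrite !inE.
  - by exists 1; rewrite ?hornerC // => i; rewrite coef1; case: eqP.
  - move=> [p Rp ->] [q Rq ->]; exists (p - q); rewrite ?hornerE // => i.
    by rewrite coefB; apply: RB.
  - move=> [p Rp ->] [q Rq ->]; exists (p * q); rewrite ?hornerE // => i.
    by rewrite coefM; apply: Rsum => j _; apply: RM.
have [|p Rp tp] := maxR subS.
  split=> [u Ru|/(_ z) Rz].
    by exists u%:P; rewrite ?hornerC // => i; rewrite coefC; case: ifP.
  apply/nRz/Rz; exists 'X; rewrite ?hornerX // => i.
  by rewrite coefX; case: eqP.
exists (t *: p); first by move=> i; exists p`_i; rewrite ?coefZ.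
by rewrite hornerZ -tp mulfV.
Qed.

(** [t] lies in the Jacobson radical of [R]: localizing at [1 - t * a] does not
    produce [t^-1], as [1 - t * a] is congruent to [1] modulo [t R]. *)
Lemma one_sub_unit a : R a -> R (1 - t * a)^-1.
Proof.
move=> Ra; apply: contrapT => nR; set d := 1 - t * a in nR.
have Rd : R d by apply: RB => //; apply: RM.
have d0 : d != 0 by apply/eqP => d0; apply: nR; rewrite d0 invr0.
have [p Ip p1] := adjoin_inverse nR.
have dX n : exists2 b, R b & d ^+ n = 1 - t * b.
  elim: n => [|n [b Rb dn]]; first by exists 0; rewrite ?mulr0 ?subr0.
  have dE : (1 - t * a) * (1 - t * b) = 1 - t * (a + b - t * a * b) by ring.
  rewrite exprS dn /d dE; exists (a + b - t * a * b) => //.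
  by apply: RB; [apply: RD | apply: RM => //; apply: RM].
have [b Rb db] := dX (size p).
suff [c Rc tc] : exists2 c, R c & t * c = d ^+ size p.
  apply: tVR; suff -> : t^-1 = c + b by apply: RD.
  by apply: (mulfI t0); rewrite mulfV // mulrDr tc db subrK.
have [|c cP] := @choice _ _ (fun i c => R c /\ p`_i = t * c).
  by move=> i; have [e Re pe] := Ip i; exists e.
exists (\sum_(i < size p) c i * d ^+ (size p - i)).
  by apply: Rsum => i _; apply: RM; [case: (cP i) | apply: RX].
rewrite -[RHS]mulr1 -p1 horner_coef !mulr_sumr; apply: eq_bigr => i _.
have [_ ->] := cP i; rewrite [RHS]mulrCA mulrA; congr (_ * _).
by rewrite exprVn -[in d ^+ size p](subnK (ltnW (ltn_ord i))) exprD mulfK // expf_neq0.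
Qed.

(** Multiplied by a power of [z], the relation of lower degree becomes an
    expression of the top power of [z] by lower ones, as its constant
    coefficient differs from [1] by a unit; substituting it into the other
    relation lowers the degree of the latter.  The descent can only end in the
    absurd relation [0 = 1].  The hypotheses are symmetric under
    [z |-> z^-1]. *)
Lemma no_two_relations N z p q :
    (size p + size q <= N)%N -> z != 0 ->
    (forall i, exists2 a, R a & p`_i = t * a) ->
    (forall i, exists2 a, R a & q`_i = t * a) ->
  p.[z] = 1 -> q.[z^-1] = 1 -> False.
Proof.
elim: N z p q => [|N IHN] z p q.
  rewrite leqn0 addn_eq0 size_poly_eq0 => /andP[/eqP-> _] _ _ _.
  by rewrite horner0 => /esym/eqP; rewrite oner_eq0.
wlog le_qp : z p q / (size q <= size p)%N.
  move=> wl sz z0 Ip Iq p1 q1.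
  have [le|/ltnW le] := leqP (size q) (size p); first exact: (wl z p q).
  by apply: (wl z^-1 q p); rewrite ?invrK ?invr_eq0 // addnC.
move=> sz z0 Ip Iq p1 q1.
have [n szp] : exists n, size p = n.+1.
  case szp: (size p) => [|n]; last by exists n.
  move: p1; have /eqP-> : p == 0 by rewrite -size_poly_eq0 szp.
  by rewrite horner0 => /esym/eqP; rewrite oner_eq0.
have [a Ra q0] := Iq 0; pose d := 1 - t * a.
have Rd : R d^-1 by apply: one_sub_unit.
have d0 : d != 0.
  apply/eqP => d0; apply: tVR; suff -> : t^-1 = a by [].
  by apply: (mulfI t0); rewrite mulfV //; apply/eqP; rewrite -subr_eq0 -/d d0.
(* the relation q, solved for its constant term and multiplied by z ^+ n *)
have qz : z ^+ n * d = \sum_(i < n) q`_(n - i) * z ^+ i.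
  rewrite /d -q0 -[X in X - _]q1 (horner_coef_wide _ (n := n.+1)) -?szp // szp.
  rewrite big_ord_recl /= expr0 mulr1 addrAC subrr add0r mulr_sumr.
  rewrite (reindex_inj rev_ord_inj) /=; apply: eq_bigr => i _.
  rewrite /bump /= add1n subnSK // mulrCA; congr (_ * _).
  rewrite exprVn -{1}(subnK (ltnW (ltn_ord i))) addnC exprD mulfK //.
  exact: expf_neq0.
pose p' := \poly_(i < n) (p`_i + p`_n * d^-1 * q`_(n - i)).
apply: (IHN z p' q) => //.
- rewrite -ltnS (leq_trans _ sz) // szp addSn ltnS leq_add2r; exact: size_poly.
- move=> i; rewrite coef_poly; case: ifP => _; last by exists 0; rewrite ?mulr0.
  have [b Rb ->] := Ip i; have [c Rc ->] := Ip n; have [e Re ->] := Iq (n - i)%N.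
  exists (b + c * d^-1 * (t * e)); last by rewrite mulrDr !mulrA.
  by apply: RD => //; do 2?apply: RM => //; apply: RM.
- rewrite horner_poly; under eq_bigr do rewrite mulrDl -mulrA.
  rewrite big_split /= -mulr_sumr -qz.
  rewrite mulrACA mulVf // mulr1.
  by move: p1; rewrite horner_coef szp big_ord_recr /=.
Qed.

Lemma maximal_subringVor z : R z \/ R z^-1.
Proof.
apply: contrapT => /not_orP[nRz nRzV].
have z0 : z != 0 by apply: contra_notN nRz => /eqP->.
have [p Ip p1] := adjoin_inverse nRz; have [q Iq q1] := adjoin_inverse nRzV.
exact: no_two_relations (leqnn _) z0 Ip Iq p1 q1.
Qed.

End MaximalSubring.

(** Chevalley's extension theorem.  By Zorn's lemma there is a maximal subring
    among those that contain [A] and avoid [t^-1]; it is a valuation ring by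
    [maximal_subringVor], and [t] is a nonunit of it. *)
Theorem place_extension (A : set F) t :
    GRing.subring_closed [in A] -> range iota `<=` A -> A t -> ~ A t^-1 ->
  exists2 P : place iota, A `<=` place_ring P & place_ideal P t.
Proof.
move=> subA KA At tVA.
(* The empty chain forces the empty set to be admitted as well. *)
pose good R := R = set0 \/
  [/\ GRing.subring_closed [in R], A `<=` R & ~ R t^-1].
have [C Cgood Ctot|R [goodR maxR]] := @Zorn_bigcup _ good.
  have [[X0 [CX0 X0n0]]|allE] := pselect (exists X, C X /\ X <> set0); last first.
    left; apply/seteqP; split=> // u [X CX Xu].
    by apply: allE; exists X; split=> // X0; rewrite X0 in Xu.
  right; have subX X : C X -> X <> set0 ->
      [/\ GRing.subring_closed [in X], A `<=` X & ~ X t^-1].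
    by move=> CX Xn0; case: (Cgood X CX).
  have Xn0 (X : set F) u : X u -> X <> set0 by move=> Xu Xe; rewrite Xe in Xu.
  have closed2 (op : F -> F -> F) :
      (forall X, C X -> X <> set0 -> forall u v, X u -> X v -> X (op u v)) ->
      forall u v, (\bigcup_(X in C) X) u -> (\bigcup_(X in C) X) v ->
      (\bigcup_(X in C) X) (op u v).
    move=> opX u v [X CX Xu] [Y CY Yv]; have [XY|YX] := Ctot X Y CX CY.
      by exists Y => //; apply: opX => //; [exact: (Xn0 _ _ Yv) | exact: XY].
    by exists X => //; apply: opX => //; [exact: (Xn0 _ _ Xu) | exact: YX].
  split=> [|u Au|[X CX Xt]].
  - split=> [|u v|u v]; rewrite !inE.
    + by exists X0 => //; case: (subX X0 CX0 X0n0) => -[+ _ _] _ _; rewrite inE.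
    + apply: (closed2 (fun a b => a - b)) => X CX Xn {}u {}v Xu Xv.
      by case: (subX X CX Xn) => -[_ + _] _ _ => /(_ u v); rewrite !inE; apply.
    + apply: (closed2 *%R) => X CX Xn {}u {}v Xu Xv.
      by case: (subX X CX Xn) => -[_ _ +] _ _ => /(_ u v); rewrite !inE; apply.
  - by exists X0 => //; case: (subX X0 CX0 X0n0) => _ + _; apply.
  - by case: (subX X CX (Xn0 _ _ Xt)).
have goodA : good A by right; split.
case: goodR => [R0|[subR AR tVR]].
  case: (maxR A) => //; rewrite R0; split=> // A0.
  by have /A0 := At.
have Rt := AR _ At.
have valR z : R z \/ R z^-1.
  apply: (@maximal_subringVor R t) => // S subS RS; apply: contrapT => tVS.
  apply: (maxR S RS); right; split=> //.
  by apply: subset_trans AR _; case: RS.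
have RP : is_valuation_ring iota R.
  split=> //; split=> //.
  - exact: subset_trans KA AR.
  - move=> /(_ _ Rt)[a _ at_]; apply: tVA; rewrite -at_ -fmorphV.
    by apply: KA; exists a^-1.
  - by move=> /(_ t^-1 I).
by exists (Place RP) => //; apply/place_idealP; right.
Qed.

End Chevalley.

(** * Radical extensions *)

Section RadicalExtension.
Variables (L : fieldType) (F : fieldExtType L) (w : F) (m : nat) (g : L).
Hypotheses (m0 : (0 < m)%N) (genw : <<1; w>>%VS = fullv) (wm : w ^+ m = g%:A).

Let monic_radical : 'X^m - g%:P \is monic.
Proof. exact: monicXnsubC. Qed.

Let radical_horner (p : {poly L}) :
  (map_poly (in_alg F) (p * ('X^m - g%:P))).[w] = 0.
Proof.
by rewrite rmorphM rmorphB /= map_polyXn map_polyC !hornerE /= wm subrr mulr0.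
Qed.

(** Reduce a polynomial expression in [w] modulo ['X^m - g]. *)
Lemma radical_expand z : exists c : 'I_m -> L, z = \sum_(i < m) (c i)%:A * w ^+ i.
Proof.
have /Fadjoin1_polyP[p ->] : z \in <<1; w>>%VS by rewrite genw memvf.
exists (fun i => (p %% ('X^m - g%:P))`_i).
rewrite {1}(divp_eq p ('X^m - g%:P)) rmorphD hornerD radical_horner add0r.
rewrite (horner_coef_wide _ (n := m)).
  by apply: eq_bigr => i _; rewrite coef_map.
rewrite size_map_poly -ltnS -[X in (_ < X)%N](size_XnsubC g m0).
by rewrite ltn_modp monic_neq0.
Qed.

Hypothesis freew : forall c : 'I_m -> L,
  \sum_(i < m) (c i)%:A * w ^+ i = 0 -> forall i, c i = 0.

(** The minimal polynomial divides ['X^m - g], and a proper divisor would be a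
    relation between the powers below [m]. *)
Lemma radical_minPoly : minPoly 1 w = map_poly (in_alg F) ('X^m - g%:P).
Proof.
have [p pE] := polyOver1P (minPolyOver 1 w).
have p_monic : p \is monic by rewrite -(map_monic (in_alg F)) -pE monic_minPoly.
have dvd : p %| 'X^m - g%:P.
  rewrite -(dvdp_map (in_alg F)) -pE; apply: minPoly_dvdp; first exact: alg_polyOver.
  by rewrite rootE -[X in map_poly _ X]mul1r radical_horner.
rewrite pE; congr map_poly; apply/eqP; rewrite -eqp_monic //.
rewrite -dvdp_size_eqp // size_XnsubC // eqn_leq.
have := dvdp_leq (monic_neq0 monic_radical) dvd; rewrite size_XnsubC // => -> /=.
rewrite ltnNge; apply/negP => sz.
have sz0 : (0 < size p)%N by rewrite size_poly_gt0 monic_neq0.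
have lt_m : ((size p).-1 < m)%N by rewrite prednK.
have pw : \sum_(i < m) (p`_i)%:A * w ^+ i = 0.
  rewrite -[RHS](minPolyxx 1 w) pE (horner_coef_wide _ (n := m)) ?size_map_poly //.
  by apply: eq_bigr => i _; rewrite coef_map.
have /eqP := freew pw (Ordinal lt_m).
by rewrite /= -lead_coefE (monicP p_monic) oner_eq0.
Qed.

(** [w] and [zeta *: w] have the same minimal polynomial. *)
Lemma radical_automorphism (zeta : L) : zeta ^+ m = 1 ->
  exists s : 'AEnd(F), s w = zeta *: w.
Proof.
move=> zm; have rt : root (map_poly \1%VF (minPoly 1 w)) (zeta *: w).
  rewrite lfun1_poly radical_minPoly rootE rmorphB /= map_polyXn map_polyC !hornerE /=.
  by rewrite exprZn zm scale1r wm subrr.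
have := kHomExtendP (subvv 1%AS) (kHom1 1 1) rt.
rewrite genw k1HomE => homf; exists (AHom homf).
exact: (kHomExtend_val (kHom1 1 1)).
Qed.

End RadicalExtension.

Lemma closed_prim_root (K : closedFieldType) (m : nat) :
  m%:R != 0 :> K -> exists zeta : K, m.-primitive_root zeta.
Proof.
move=> mK; have m0 : (0 < m)%N by case: m mK; rewrite ?eqxx.
pose p : {poly K} := 'X^m - 1; have [s Dp] := closed_field_poly_normal p.
rewrite (monicP _) ?monicXnsubC // scale1r in Dp.
have rn1 : all m.-unity_root s by apply/allP=> z; rewrite -root_prod_XsubC -Dp.
have sz_s : (m < (size s).+1)%N by rewrite -(size_prod_XsubC s id) -Dp size_XnsubC.
have [|z] := hasP (cyclic.has_prim_root m0 rn1 _ sz_s); last by exists z.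
by rewrite -separable_prod_XsubC -Dp separable_Xn_sub_1.
Qed.

Lemma prim_root_sum (K : fieldType) (m : nat) (zeta : K) (i j : nat) :
    m.-primitive_root zeta -> (i < m)%N -> (j < m)%N ->
  \sum_(k < m) (zeta ^+ j / zeta ^+ i) ^+ k = if i == j then m%:R else 0.
Proof.
move=> zeta_prim im jm; have zeta0 : zeta != 0.
  by rewrite (prim_root_eq0 zeta_prim) -lt0n (leq_ltn_trans _ im).
case: eqVneq => [->|ij].
  rewrite mulfV ?expf_neq0 //; under eq_bigr do rewrite expr1n.
  by rewrite sumr_const card_ord.
set u := _ / _; have u1 : u != 1.
  apply: contra_neq ij => /(canRL (divfK (expf_neq0 i zeta0)))/eqP.
  by rewrite mul1r (eq_prim_root_expr zeta_prim) !modn_small // => /eqP.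
have um : u ^+ m = 1.
  by rewrite exprMn exprVn -!exprM mulnC [(i * m)%N]mulnC !exprM (prim_expr_order zeta_prim) !expr1n divr1.
by apply: (mulfI (_ : u - 1 != 0)); rewrite ?subr_eq0 // -subrX1 um subrr mulr0.
Qed.

(** * Rational functions *)

Section RationalFunctions.
Variables (K : fieldType) (F : fieldExtType {fraction {poly K}}).

Lemma ratfun_frac (c : {fraction {poly K}}) : exists a b : {poly K},
  [/\ b != 0, coprimep a b & c = FracField.tofrac a / FracField.tofrac b].
Proof.
have [n [d [d0 ->]]] : exists n d : {poly K},
    d != 0 /\ c = FracField.tofrac n / FracField.tofrac d.
  elim/quotW: c => -[[n d] /= d0]; exists n, d; split=> //.
  apply: (canRL (mulfK _)); first by rewrite tofrac_eq0.
  rewrite -[LHS]/(FracField.mul _ _) !piE; apply/eqmodP.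
  rewrite /= FracField.equivfE /FracField.mulf !numden_Ratio ?mulf_neq0 ?oner_eq0 //=.
  by rewrite !mulr1 mulrC.
have g0 : gcdp n d != 0 by rewrite gcdp_eq0 negb_and d0 orbT.
exists (n %/ gcdp n d), (d %/ gcdp n d); split.
- by rewrite dvdp_div_eq0 ?dvdp_gcdr.
- by rewrite coprimep_div_gcd // d0 orbT.
have gn := divpK (dvdp_gcdl n d); have gd := divpK (dvdp_gcdr n d).
set g := gcdp n d in g0 gn gd *.
rewrite -[in LHS]gn -[in LHS]gd !rmorphM /=.
by rewrite invfM mulrACA mulfV ?mulr1 // tofrac_eq0.
Qed.

Definition poly_ext : {rmorphism {poly K} -> F} :=
  ratfun_ext F \o @FracField.tofrac {poly K}.

Lemma poly_extC c : poly_ext c%:P = ext_const F c.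
Proof. by []. Qed.

Lemma poly_ext_eq0 p : (poly_ext p == 0) = (p == 0).
Proof. by rewrite fmorph_eq0 tofrac_eq0. Qed.

Lemma poly_ext_expand p :
  poly_ext p = \sum_(i < size p) ext_const F p`_i * poly_ext 'X ^+ i.
Proof.
rewrite -{1}[p]coefK poly_def rmorph_sum; apply: eq_bigr => i _.
by rewrite -mul_polyC rmorphM rmorphXn.
Qed.

Lemma place_ring_poly (P : place (ext_const F)) p :
  place_ring P (poly_ext 'X) -> place_ring P (poly_ext p).
Proof.
move=> Px; rewrite poly_ext_expand; apply: place_ring_sum => i _.
by apply: place_ringM; [apply: place_ring_const | apply: place_ringX].
Qed.

(** At a place where [x] has a pole, the leading term of a polynomial
    dominates. *)
Lemma poly_order (P : place (ext_const F)) p :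
    ~ place_ring P (poly_ext 'X) -> p != 0 ->
  has_order P (poly_ext 'X) (poly_ext p) (size p).-1%:Z.
Proof.
set x := poly_ext 'X => nPx p0.
have x0 : x != 0 by rewrite poly_ext_eq0 polyX_eq0.
have ix : place_ideal P x^-1 by apply/place_idealP; right; rewrite invrK.
have ordV z (e : int) : has_order P x^-1 z (- e) <-> has_order P x z e.
  by rewrite /has_order exprz_inv !opprK.
case sp: (size p) => [|n]; first by move: p0; rewrite -size_poly_eq0 sp.
rewrite poly_ext_expand sp [n.+1.-1]/=; apply/ordV.
have ord_mono c i : c != 0 -> has_order P x^-1 (ext_const F c * x ^+ i) (- i%:Z).
  move=> c0; apply/ordV; rewrite /has_order -mulrA exprnP -expfzDr // subrr mulr1.
  exact: place_unit_const.
have xV0 : x^-1 != 0 by rewrite invr_eq0.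
apply: (order_min ix xV0 (fun i : 'I_n.+1 => _) (fun i => - (i : nat)%:Z) (i0 := ord_max)).
- apply: ord_mono; have := p0; rewrite -lead_coef_eq0 lead_coefE sp.
  exact.
move=> i ni; have [->|pi0] := eqVneq p`_i 0; first by left; rewrite rmorph0 mul0r.
right; split; first exact: ord_mono.
by rewrite ltrN2 ltz_nat ltn_neqAle -ltnS ltn_ord andbT.
Qed.

(** The integer is the degree of [c]; it serves all poles of [x] at once, which
    is what makes the pole of [x] unique later on. *)
Lemma ratfun_order (c : {fraction {poly K}}) : c != 0 ->
  exists d : int, forall P : place (ext_const F),
    ~ place_ring P (poly_ext 'X) -> has_order P (poly_ext 'X) (c%:A : F) d.
Proof.
have [a [b [b0 _ ->]]] := ratfun_frac c.
rewrite mulf_eq0 invr_eq0 !tofrac_eq0 (negPf b0) orbF => a0.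
exists ((size a).-1%:Z + (size b).-1%:Z * - 1) => P nPx.
have x0 : poly_ext 'X != 0 by rewrite poly_ext_eq0 polyX_eq0.
have -> : (FracField.tofrac a / FracField.tofrac b)%:A =
    poly_ext a * poly_ext b ^ (-1) :> F.
  by rewrite exprN1 -in_algE rmorphM fmorphV.
apply: orderM => //; first exact: poly_order.
by apply: orderXz; apply: poly_order.
Qed.

End RationalFunctions.

(** * Places over the affine line *)

Section FinitePlaces.
Variables (K : fieldType) (F : fieldExtType {fraction {poly K}}).
Local Notation px := (@poly_ext K F).
Implicit Types (P : place (ext_const F)) (b : K) (p q : {poly K}).

(** ['X - b] has no inverse among the polynomials, as it vanishes at [b]. *)
Lemma place_over b : exists2 P : place (ext_const F),
  place_ring P (px 'X) & place_ideal P (px ('X - b%:P)).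
Proof.
have [| | | |P AP iP] := @place_extension K F (ext_const F) (range px) (px ('X - b%:P)).
- split=> [|u v|u v]; rewrite !inE.
  + by exists 1; rewrite ?rmorph1.
  + by move=> [p _ <-] [q _ <-]; exists (p - q); rewrite ?rmorphB.
  + by move=> [p _ <-] [q _ <-]; exists (p * q); rewrite ?rmorphM.
- by move=> _ [c _ <-]; exists c%:P.
- by exists ('X - b%:P).
- move=> [g _ gE]; have g1 : g * ('X - b%:P) = 1.
    apply/eqP; rewrite -subr_eq0 -(poly_ext_eq0 F) rmorphB rmorph1 rmorphM gE.
    by rewrite mulVf ?subrr // poly_ext_eq0 polyXsubC_eq0.
  have /eqP := congr1 (fun p => p.[b]) g1.
  by rewrite !hornerE subrr mulr0 eq_sym oner_eq0.
by exists P => //; apply: AP; exists 'X.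
Qed.

(** Such a polynomial is congruent to its nonzero value at [b] modulo
    ['X - b]. *)
Lemma poly_unit_over P b p :
    place_ring P (px 'X) -> place_ideal P (px ('X - b%:P)) -> p.[b] != 0 ->
  place_unit P (px p).
Proof.
move=> Px iP pb0; have : root (p - p.[b]%:P) b by rewrite rootE !hornerE subrr.
case/factor_theorem => q pE; have -> : p = p.[b]%:P + ('X - b%:P) * q.
  by rewrite mulrC -pE addrC subrK.
rewrite rmorphD rmorphM; apply: place_unitD_ideal.
  by rewrite poly_extC; apply: place_unit_const.
by apply: place_idealM => //; apply: place_ring_poly.
Qed.

End FinitePlaces.

(** The nonunit [s u] guarantees that the pulled back ring is strictly between
    the constants and the whole field: it contains [u] and not [u^-1]. *)
Lemma place_pullback (K F : fieldType) (iota : {rmorphism K -> F}) (P : place iota)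
    (s : {rmorphism F -> F}) (u : F) :
    (forall a, s (iota a) = iota a) -> u != 0 -> place_ideal P (s u) ->
  exists Q : place iota, place_ring Q = s @^-1` place_ring P.
Proof.
move=> sK u0 iu; set O := _ @^-1` _.
suff OP : is_valuation_ring iota O by exists (Place OP).
split.
- split=> [|a b|a b]; rewrite !inE /O /=.
  + by rewrite rmorph1; apply: place_ring1.
  + by rewrite rmorphB; apply: place_ringB.
  + by rewrite rmorphM; apply: place_ringM.
- split=> [_ [a _ <-]|/(_ u)]; first by rewrite /O /= sK; apply: place_ring_const.
  case=> [|a _ au]; first exact: place_ideal_ring.
  move: iu; rewrite -au sK; apply: place_unit_not_ideal; apply: place_unit_const.
  by apply: contraNneq u0 => a0; rewrite -au a0 rmorph0.
- split=> // /(_ u^-1 I); rewrite /O /= fmorphV.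
  by have [/eqP|//] := (place_idealP P (s u)).1 iu; rewrite fmorph_eq0 (negPf u0).
- by move=> z; rewrite /O /= fmorphV; apply: place_ringVor.
Qed.

(** * Residues modulo [m] *)

Lemma residue_inj (m S i j : nat) : gcdn m S = 1%N -> (i < m)%N -> (j < m)%N ->
  (m%:Z %| (i%:Z - j%:Z) * S%:Z)%Z -> i = j.
Proof.
move=> mS im jm; rewrite Gauss_dvdzl ?/coprimez /gcdz /= ?mS // => /dvdzP[q qE].
have q0 : q = 0 by nia.
by rewrite q0 mul0r in qE; lia.
Qed.

(** [S] is invertible modulo [m], so the class of [s] prescribes that of [i]. *)
Lemma residue_exists (m S s : nat) : (0 < m)%N -> gcdn m S = 1%N ->
  exists i j : nat, (i < m)%N /\ (s + i * S = m * j)%N.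
Proof.
move=> m0 mS; have [u [v uv]] : exists u v : int, u * m%:Z + v * S%:Z = 1.
  by have [u [v]] := Bezoutz m S; rewrite /gcdz /= mS; exists u, v.
have m_nz : m%:Z != 0 by lia.
have iE := divz_eq (- (s%:Z * v)) m%:Z; have := modz_ge0 (- (s%:Z * v)) m_nz.
have := ltz_pmod (- (s%:Z * v)) (_ : 0 < m%:Z).
move: (modz _ _) (divz _ _) iE => i q iE /(_ m0) im i0.
have sE : s%:Z + i * S%:Z = m%:Z * (s%:Z * u - q * S%:Z).
  have -> : i = - (s%:Z * v) - q * m%:Z by rewrite iE addrAC subrr add0r.
  by rewrite -[X in X + _ = _]mulr1 -uv; ring.
move: i sE i0 im {iE} => [i|//] sE _ im.
have : 0 <= m%:Z * (s%:Z * u - q * S%:Z) by rewrite -sE; lia.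
rewrite pmulr_rge0 //; move: (_ - _) sE => [j|//] sE _.
by exists i, j; lia.
Qed.

(** * The curve and its place at infinity *)

Section KummerCurve.
Variables (K : closedFieldType) (F : fieldExtType {fraction {poly K}}).
Variables (r m : nat) (alpha : 'I_r -> K) (lambda : 'I_r -> nat) (y : F).

Local Notation L := {fraction {poly K}}.
Local Notation px := (@poly_ext K F).
Local Notation x := (px 'X).
Local Notation w := (y^-1).
Local Notation lambda0 := (\sum_(l < r) lambda l)%N.

Definition linear_product (e : 'I_r -> nat) : {poly K} :=
  \prod_(l < r) ('X - (alpha l)%:P) ^+ e l.

Local Notation f := (linear_product lambda).

Lemma linear_product_neq0 e : linear_product e != 0.
Proof. by apply/prodf_neq0 => l _; rewrite expf_neq0 // polyXsubC_eq0. Qed.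

Lemma size_linear_product e : size (linear_product e) = (\sum_(l < r) e l).+1.
Proof.
rewrite size_prod => [|l _]; last by rewrite expf_neq0 // polyXsubC_eq0.
under eq_bigr do rewrite size_exp_XsubC -addn1.
by rewrite big_split /= sum1_card -addSn addnK.
Qed.

Lemma linear_productD e e' :
  linear_product (fun l => e l + e' l)%N = linear_product e * linear_product e'.
Proof. by rewrite -big_split; apply: eq_bigr => l _; rewrite exprD. Qed.

Lemma linear_productX e n :
  linear_product (fun l => e l * n)%N = linear_product e ^+ n.
Proof. by rewrite -prodrXl; apply: eq_bigr => l _; rewrite exprM. Qed.

(** The multiplicity of a root of a product of powers of distinct linear
    factors is one of the exponents, or zero. *)
Lemma linear_product_mult e n b : injective alpha -> (0 < n)%N ->
    (forall l, e l < n)%N ->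
  exists k q, [/\ (k < n)%N, linear_product e = ('X - b%:P) ^+ k * q & q.[b] != 0].
Proof.
move=> inj_alpha n0 en.
have [[l ->]|nb] := pselect (exists l, b = alpha l).
  exists (e l), (\prod_(j < r | j != l) ('X - (alpha j)%:P) ^+ e j); split=> //.
    by rewrite /linear_product (bigD1 l).
  rewrite horner_prod; apply/prodf_neq0 => j jl.
  by rewrite !hornerE expf_neq0 // subr_eq0 (inj_eq inj_alpha) eq_sym.
exists 0, (linear_product e); rewrite expr0 mul1r; split=> //.
rewrite horner_prod; apply/prodf_neq0 => j _.
rewrite !hornerE expf_neq0 // subr_eq0; apply/eqP => bj; apply: nb.
by exists j.
Qed.

Definition ceil_divn (n d : nat) : nat := ((n + d.-1) %/ d)%N.

Lemma ceil_divnP n d : (0 < d)%N -> (n <= ceil_divn n d * d < n + d)%N.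
Proof.
move=> d0; rewrite /ceil_divn; have := divn_eq (n + d.-1) d.
by have := ltn_pmod (n + d.-1) d0; lia.
Qed.

Local Notation ceil i := (fun l => ceil_divn (i * lambda l) m).

(** [m] times the error made in rounding [i * lambda l / m] up. *)
Definition excess i : 'I_r -> nat := fun l => (ceil i l * m - i * lambda l)%N.

Hypotheses (m0 : (0 < m)%N) (y_m : y ^+ m = px f).

Lemma y_neq0 : y != 0.
Proof.
have : y ^+ m != 0 by rewrite y_m poly_ext_eq0 linear_product_neq0.
by rewrite expf_eq0 m0.
Qed.

Lemma x_neq0 : x != 0.
Proof. by rewrite poly_ext_eq0 polyX_eq0. Qed.

Lemma w_m : w ^+ m = ((FracField.tofrac f)^-1)%:A.
Proof. by rewrite exprVn y_m -in_algE fmorphV. Qed.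

Hypothesis coprime_m : gcdn m lambda0 = 1%N.

(** With [a * m + b * lambda0 = - 1], the [m]-th power of [t = x ^ a * y ^ b]
    has order [- 1] in units of [x].  This fixes the order of [x] in units of
    [t], hence that of [y ^+ m] and, by extraction of roots, that of [y]. *)
Lemma uniformizer : exists2 t : F, t != 0 & forall P : place (ext_const F),
  ~ place_ring P x -> [/\ place_ideal P t, has_order P t x (- m%:Z) &
    has_order P t w lambda0%:Z].
Proof.
have [a [b ab]] : exists a b : int, a * m%:Z + b * lambda0%:Z = - 1.
  have [u [v uv]] := Bezoutz m lambda0; exists (- u), (- v).
  by rewrite !mulNr -opprD uv /gcdz /= coprime_m.
have t0 : x ^ a * y ^ b != 0 by rewrite mulf_neq0 ?expfz_neq0 ?x_neq0 ?y_neq0.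
exists (x ^ a * y ^ b) => // P nPx; set t := x ^ a * y ^ b in t0 *.
have oy : has_order P x (y ^+ m) lambda0%:Z.
  rewrite y_m; have := poly_order nPx (linear_product_neq0 lambda).
  by rewrite size_linear_product.
have ox : has_order P x x 1.
  by rewrite /has_order exprN1 mulfV ?x_neq0 //; apply: place_unit1.
have ot : has_order P x (t ^+ m) (- 1).
  have -> : t ^+ m = x ^ (a * m%:Z) * (y ^+ m) ^ b.
    by rewrite exprMn !exprnP !exprz_exp [b * _]mulrC.
  have := orderM x_neq0 (orderXz (a * m%:Z) ox) (orderXz b oy).
  by rewrite mul1r [_ * b]mulrC ab.
have otx : has_order P t x (- m%:Z).
  by move: ot; rewrite /has_order opprK expr1z mulrC opprK.
split=> //.
  apply/place_idealP; right=> PtV; apply: nPx.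
  have -> : x = x * t ^+ m * t^-1 ^+ m.
    by rewrite exprVn mulfK // expf_neq0.
  apply: place_ringM; last exact: place_ringX.
  by move: otx; rewrite /has_order opprK => -[].
apply: (order_root m0); rewrite exprVn -exprN1.
have -> : lambda0%:Z * m%:Z = - m%:Z * lambda0%:Z * -1 by rewrite mulrN1 mulNr opprK mulrC.
by apply: orderXz; apply: order_trans otx oy.
Qed.

Section Uniformizer.
Variable t : F.
Hypotheses (t0 : t != 0) (tP : forall P : place (ext_const F),
  ~ place_ring P x -> [/\ place_ideal P t, has_order P t x (- m%:Z) &
    has_order P t w lambda0%:Z]).

(** The orders of the nonzero terms of an expansion in powers of [w] are
    pairwise incongruent modulo [m], as [m] and [lambda0] are coprime, so that
    exactly one term dominates.  Which one does not depend on the place. *)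
Lemma expansion_order (c : 'I_m -> L) : (exists i, c i != 0) ->
  exists (i : 'I_m) (d : int), c i != 0 /\
    forall P : place (ext_const F), ~ place_ring P x ->
      has_order P x ((c i)%:A : F) d /\
      has_order P t (\sum_(i < m) (c i)%:A * w ^+ i)
                    (lambda0%:Z * i%:Z - m%:Z * d).
Proof.
case=> i0 ci0.
have [d dP] : {d : 'I_m -> int & forall i, c i != 0 ->
    forall P : place (ext_const F), ~ place_ring P x ->
      has_order P x ((c i)%:A : F) (d i)}.
  apply: (@choice _ _ (fun i d => c i != 0 -> forall P : place (ext_const F),
    ~ place_ring P x -> has_order P x ((c i)%:A : F) d)) => i.
  have [ci|/(ratfun_order F)[d dP]] := eqVneq (c i) 0; [by exists 0 | by exists d].
pose e (i : 'I_m) : int := lambda0%:Z * i%:Z - m%:Z * d i.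
case: (@Order.TotalTheory.arg_minP _ _ _ i0 (fun i => c i != 0) e ci0) => i ci mini; exists i, (d i); split=> // P nPx.
split; first exact: dP.
have [it ox ow] := tP nPx.
have oE j : c j != 0 -> has_order P t ((c j)%:A * w ^+ j) (e j).
  move=> cj; rewrite /e addrC; apply: orderM => //.
    by rewrite -mulNr; apply: order_trans ox _ => //; apply: dP.
  by rewrite exprnP; apply: orderXz.
apply: (order_min it t0 _ e); first exact: oE.
move=> j ji; have [->|cj] := eqVneq (c j) 0; first by left; rewrite scale0r mul0r.
right; split; first exact: oE.
rewrite lt_neqAle mini // andbT; apply: contra ji => /eqP eij.
have eqn : (i%:Z - j%:Z) * lambda0%:Z = (d i - d j) * m%:Z.
  by move: eij; rewrite /e; lia.
rewrite -val_eqE /= eq_sym (residue_inj coprime_m (ltn_ord i) (ltn_ord j)) ?eqxx //.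
by rewrite eqn dvdz_mull.
Qed.

Hypothesis gen_y : <<1; y>>%VS = fullv.

Lemma gen_w : <<1; w>>%VS = fullv.
Proof.
apply/eqP; rewrite eqEsubv subvf -gen_y; apply/FadjoinP; split; first exact: subv_adjoin.
by rewrite -memvV memv_adjoin.
Qed.

Lemma w_expand z : exists c : 'I_m -> L, z = \sum_(i < m) (c i)%:A * w ^+ i.
Proof. exact: (radical_expand m0 gen_w w_m). Qed.

Lemma element_order z : z != 0 -> exists e : int,
  forall P : place (ext_const F), ~ place_ring P x -> has_order P t z e.
Proof.
have [c ->] := w_expand z => z0.
have [|i [d [_ cP]]] := @expansion_order c.
  apply: contrapT => c0; move: z0; rewrite big1 ?eqxx // => i _.
  have [->|ci] := eqVneq (c i) 0; first by rewrite scale0r mul0r.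
  by case: c0; exists i.
by eexists => P /cP[_]; apply.
Qed.

Lemma uniformizer_prime (P : place (ext_const F)) :
  ~ place_ring P x -> prime_element P t.
Proof.
move=> nPx; have [it _ _] := tP nPx.
by apply: (prime_of_order it t0) => z /element_order[e eP]; exists e; apply: eP.
Qed.

(** The valuation ring consists of [0] and the elements of nonnegative order,
    and orders do not depend on the place. *)
Lemma infinite_place_unique (P Q : place (ext_const F)) :
  ~ place_ring P x -> ~ place_ring Q x -> P = Q.
Proof.
move=> nPx nQx; have [iP _ _] := tP nPx; have [iQ _ _] := tP nQx.
apply/place_inj/seteqP; split=> z; have [->|z0] := eqVneq z 0;
  try by move=> _; apply: place_ring0.
  have [e eP] := element_order z0.
  by move=> /(order_ring iP t0 (eP _ nPx)) e0; apply/(order_ring iQ t0 (eP _ nQx)).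
have [e eP] := element_order z0.
by move=> /(order_ring iQ t0 (eP _ nQx)) e0; apply/(order_ring iP t0 (eP _ nPx)).
Qed.

(** * Elements without finite poles *)

Variable Q : place (ext_const F).
Hypothesis nQx : ~ place_ring Q x.

(** A nontrivial combination has an order, which [0] has not. *)
Lemma w_free (c : 'I_m -> L) :
  \sum_(i < m) (c i)%:A * w ^+ i = 0 -> forall i, c i = 0.
Proof.
move=> cw0 i; apply/eqP; apply: contraT => ci.
have [|j [d [_ /(_ Q nQx)[_]]]] := @expansion_order c; first by exists i.
by rewrite cw0 /has_order mul0r => -[]; rewrite eqxx.
Qed.

Hypothesis m_neq0 : m%:R != 0 :> K.

(** The sum over [k] of [zeta ^ (- i * k)] times the image of the element under
    [w |-> zeta ^ k w] is [m] times its [i]-th component.  The images are in the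
    ring of [P] because the element is in that of the place pulled back from
    [P], where [x] is finite too. *)
Lemma component_integral (c : 'I_m -> L) :
    (forall P : place (ext_const F), place_ring P x ->
       place_ring P (\sum_(i < m) (c i)%:A * w ^+ i)) ->
  forall (b : K) (P : place (ext_const F)),
    place_ring P x -> place_ideal P (px ('X - b%:P)) ->
  forall i, place_ring P ((c i)%:A * w ^+ i).
Proof.
set z := \sum_i _ => zint b P Px iP i.
have [zeta zeta_prim] := closed_prim_root m_neq0.
pose zL : L := ratfun_const K zeta.
have sP k : {s : 'AEnd(F) | s w = zL ^+ k *: w}.
  apply: cid; apply: (radical_automorphism m0 gen_w w_m w_free).
  by rewrite -rmorphXn -rmorphXn exprAC (prim_expr_order zeta_prim) expr1n rmorph1.
pose s k : {rmorphism F -> F} := sval (sP k).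
have sw k : s k w = zL ^+ k *: w := svalP (sP k).
have sL k a : s k a%:A = a%:A by rewrite -[LHS]/(sval (sP k) a%:A) linearZ /= rmorph1.
have spx k p : s k (px p) = px p := sL k _.
have sz k : place_ring P (s k z).
  have [| | |R RE] := @place_pullback _ _ (ext_const F) P (s k) (px ('X - b%:P)).
  - by move=> a; rewrite -poly_extC spx.
  - by rewrite poly_ext_eq0 polyXsubC_eq0.
  - by rewrite spx.
  have : place_ring R z by apply: zint; rewrite RE /preimage /= spx.
  by rewrite RE.
have extZ a v : ext_const F a * v = ratfun_const K a *: v by apply: mulr_algl.
have avg : ext_const F m%:R * ((c i)%:A * w ^+ i) =
    \sum_(k < m) ext_const F ((zeta ^+ i)^-1 ^+ k) * s k z.
  transitivity (\sum_(j < m) \sum_(k < m)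
      ext_const F ((zeta ^+ j / zeta ^+ i) ^+ k) * ((c j)%:A * w ^+ j)).
    rewrite (bigD1 i) //= [X in _ + X]big1 ?addr0 => [|j ji].
      by rewrite -mulr_suml -(rmorph_sum (ext_const F)) (prim_root_sum zeta_prim) ?eqxx.
    rewrite -mulr_suml -(rmorph_sum (ext_const F)) (prim_root_sum zeta_prim) //.
    by rewrite val_eqE eq_sym (negPf ji) rmorph0 mul0r.
  rewrite exchange_big /=; apply: eq_bigr => k _.
  rewrite rmorph_sum mulr_sumr; apply: eq_bigr => j _.
  rewrite (rmorphM (s k)) (rmorphXn (s k)) sL sw exprZn !extZ !mulr_algl !scalerA.
  congr (_ *: _); have -> : zL ^+ k ^+ j = ratfun_const K (zeta ^+ j ^+ k).
    by rewrite exprAC -!rmorphXn.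
  by rewrite exprMn rmorphM [RHS]mulrAC; congr (_ * _); apply: mulrC.
have mF : ext_const F m%:R != 0 by rewrite fmorph_eq0.
have -> : (c i)%:A * w ^+ i = ext_const F m%:R^-1 *
    (\sum_(k < m) ext_const F ((zeta ^+ i)^-1 ^+ k) * s k z).
  by rewrite -avg mulrA fmorphV mulVf // mul1r.
apply: place_ringM; first exact: place_ring_const.
by apply: place_ring_sum => k _; apply: place_ringM => //; apply: place_ring_const.
Qed.

Lemma excess_lt i l : (excess i l < m)%N.
Proof. by rewrite /excess; have := ceil_divnP (i * lambda l) m0; lia. Qed.

Lemma ceil_excess i :
  linear_product (ceil i) ^+ m = f ^+ i * linear_product (excess i).
Proof.
rewrite -!linear_productX -linear_productD; apply: eq_bigr => l _; congr (_ ^+ _).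
by rewrite /excess; have := ceil_divnP (i * lambda l) m0; lia.
Qed.

(** This shows both that the element on the left is integral, and that a
    coefficient of [w ^+ i] of smaller multiplicity would not do, the exponents
    on the right being less than [m]. *)
Lemma ceil_w_pow i :
  (px (linear_product (ceil i)) * w ^+ i) ^+ m = px (linear_product (excess i)).
Proof.
rewrite exprMn -rmorphXn ceil_excess rmorphM rmorphXn -exprM mulnC exprM exprVn y_m.
by rewrite mulrAC exprVn mulfV ?mul1r // expf_neq0 // poly_ext_eq0 linear_product_neq0.
Qed.

Hypothesis inj_alpha : injective alpha.

(** Write [c i] as [linear_product (ceil i) * (a / b)] in lowest terms and
    suppose that [b] has a root [beta].  At a place over [beta], the [m]-th power
    of the [i]-th component times [b ^+ m] is [a ^+ m] times the product of
    [ceil_w_pow].  The former has order at least [m] in units of ['X - beta], the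
    latter less than [m]. *)
Lemma component_poly (c : 'I_m -> L) :
    (forall P : place (ext_const F), place_ring P x ->
       place_ring P (\sum_(i < m) (c i)%:A * w ^+ i)) ->
  forall i : 'I_m, exists g, c i = FracField.tofrac (linear_product (ceil i) * g).
Proof.
move=> zint i; set D := linear_product (ceil i).
have D0 : FracField.tofrac D != 0 :> L by rewrite tofrac_eq0 linear_product_neq0.
have [a [b [b0 cop_ab cDE]]] := ratfun_frac (c i / FracField.tofrac D).
have B0 : FracField.tofrac b != 0 :> L by rewrite tofrac_eq0.
have b1 : size b == 1%N.
  apply/negPn/negP => /closed_rootP[beta rb].
  have [P Px iP] := place_over F beta.
  have Pu := component_integral zint Px iP i; set u := (c i)%:A * w ^+ i in Pu.
  have [k [q [km Eq qb]]] := linear_product_mult beta inj_alpha m0 (excess_lt i).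
  have [b' bE] := factor_theorem _ _ rb.
  have ab : a.[beta] != 0 by apply: coprimep_root rb; rewrite coprimep_sym.
  have uE : px b * u = px a * (px D * w ^+ i).
    rewrite /u mulrCA mulrA mulrA; congr (_ * _).
    have cE : c i * FracField.tofrac b = FracField.tofrac a * FracField.tofrac D.
      by apply/eqP; rewrite -(eqr_div _ _ D0 B0) cDE.
    transitivity (in_alg F (c i * FracField.tofrac b)).
      by rewrite rmorphM.
    by rewrite cE rmorphM.
  set tau := px ('X - beta%:P) in iP.
  have tau0 : tau != 0 by rewrite poly_ext_eq0 polyXsubC_eq0.
  have eqn : tau ^+ (m - k) * (px b' * u) ^+ m = px (a ^+ m * q).
    apply: (mulfI (expf_neq0 k tau0)); rewrite mulrA -exprD subnKC ?(ltnW km) //.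
    rewrite -exprMn mulrA [tau * _]mulrC -rmorphM -bE uE exprMn ceil_w_pow Eq.
    by rewrite !rmorphM !rmorphXn mulrCA.
  have : place_unit P (px (a ^+ m * q)).
    by apply: (poly_unit_over Px iP); rewrite !hornerE mulf_neq0 ?expf_neq0.
  rewrite -eqn => /place_unit_not_ideal; apply.
  apply: place_idealM; last first.
    by apply/place_ringX/place_ringM => //; apply: place_ring_poly.
  rewrite -[(m - k)%N]prednK ?subn_gt0 // exprS.
  by apply: place_idealM => //; apply/place_ringX/place_ideal_ring.
have [v v0 bE] := size_poly1P _ b1.
exists (v^-1 *: a); rewrite -[LHS](divfK D0) cDE mulrC rmorphM; congr (_ * _).
apply: (canLR (mulfK B0)); rewrite -rmorphM bE; congr FracField.tofrac.
by rewrite mulrC mul_polyC scalerA mulfV // scale1r.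
Qed.

(** * Pole orders *)

Lemma sum_ceil_ge i : (i * lambda0 <= m * \sum_(l < r) ceil i l)%N.
Proof.
rewrite !big_distrr /=; apply: leq_sum => l _.
by have := ceil_divnP (i * lambda l) m0; lia.
Qed.

Lemma poly_w_order (p : {poly K}) (i n : nat) : size p = n.+1 ->
  has_order Q t (px p * w ^+ i) (lambda0%:Z * i%:Z - m%:Z * n%:Z).
Proof.
move=> sp; have [_ ox ow] := tP nQx; rewrite addrC; apply: (orderM t0).
  have p0 : p != 0 by rewrite -size_poly_eq0 sp.
  by rewrite -mulNr; apply: (order_trans t0 ox); have := poly_order nQx p0; rewrite sp.
by rewrite exprnP; apply: orderXz.
Qed.

(** The order at infinity is that of the dominant term, whose coefficient is a
    multiple of [linear_product (ceil i)].  An element that has no pole at all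
    is covered by [s = 0]: then its order is nonnegative, and [sum_ceil_ge]
    says that it is nonpositive. *)
Lemma pole_order_shape (s : nat) : weierstrass_semigroup Q s ->
  exists (i : 'I_m) (j : nat),
    (\sum_(l < r) ceil i l <= j)%N /\ (s + i * lambda0 = m * j)%N.
Proof.
move=> [z [z0 zD]]; have [it _ _] := tP nQx.
have [c zE] := w_expand z.
have zint (P : place (ext_const F)) : place_ring P x -> place_ring P z.
  move=> Px; apply: contrapT => nPz; have [/(_ nPz)+ _] := zD P.
  rewrite /place_multiple; case: asboolP => [PQ|_]; first by case: nQx; rewrite -PQ.
  by move=> [t' [u [_ [_ Pu _] zu]]]; apply: nPz; rewrite zu mul1r.
have [|i [d [ci /(_ Q nQx)[oci oz]]]] := @expansion_order c.
  apply: contrapT => c0; move: z0; rewrite zE big1 ?eqxx // => i _.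
  have [->|ci] := eqVneq (c i) 0; first by rewrite scale0r mul0r.
  by case: c0; exists i.
rewrite -zE in oz zint.
have [g cE] : exists g, c i = FracField.tofrac (linear_product (ceil i) * g).
  by apply: component_poly => P; rewrite -zE; apply: zint.
set p := _ * g in cE; have p0 : p != 0 by rewrite -tofrac_eq0 -cE.
have dE : d = (size p).-1%:Z.
  have [_ ox _] := tP nQx; rewrite cE in oci.
  have := order_uniq it t0 (order_trans t0 ox oci) (order_trans t0 ox (poly_order nQx p0)).
  by apply: mulfI; rewrite oppr_eq0; lia.
have le_p : (\sum_(l < r) ceil i l <= (size p).-1)%N.
  have g0 : g != 0 by apply: contraNneq p0 => g0; rewrite /p g0 mulr0.
  rewrite size_mul ?linear_product_neq0 // size_linear_product addSn /=.
  by rewrite -subn1 -addnBA ?leq_addr // size_poly_gt0.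
exists i, (size p).-1; split=> //; rewrite {}dE in oz.
have [Qz|nQz] := pselect (place_ring Q z).
  have /(order_ring it t0 oz) := Qz.
  have [_ /(_ (fun n => n Qz))] := zD Q.
  rewrite /place_multiple asboolT // => /eqP; have := sum_ceil_ge i; nia.
have [/(_ nQz)] := zD Q; rewrite /place_multiple asboolT //.
move=> /(prime_order_valuation it t0 _ (uniformizer_prime nQx) oz); lia.
Qed.

(** The witness is [linear_product (ceil i) * x ^ n * w ^ i], with [n] chosen so
    that the polynomial has degree [j]. *)
Lemma pole_order_of_shape (i j s : nat) :
    (\sum_(l < r) ceil i l <= j)%N -> (s + i * lambda0 = m * j)%N ->
  weierstrass_semigroup Q s.
Proof.
move=> le_j sE; have [it ox ow] := tP nQx.
pose n := (j - \sum_(l < r) ceil i l)%N.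
pose p := linear_product (ceil i) * 'X^n.
have sp : size p = j.+1.
  rewrite size_mul ?linear_product_neq0 ?monic_neq0 ?monicXn // size_linear_product size_polyXn.
  by rewrite addSn addnS /n /= subnKC.
pose z := px p * w ^+ i; have oz := poly_w_order i sp; rewrite -/z in oz.
have z0 : z != 0.
  by have [+ _ _] := oz; rewrite mulf_eq0 => /norP[].
have zint (P : place (ext_const F)) : place_ring P x -> place_ring P z.
  move=> Px; apply: (place_ring_root m0).
  rewrite /z rmorphM mulrAC exprMn ceil_w_pow -rmorphXn -rmorphM.
  exact: place_ring_poly.
have nzE : lambda0%:Z * i%:Z - m%:Z * j%:Z = - s%:Z by lia.
rewrite {}nzE in oz.
exists z; split=> // P; rewrite /place_multiple; have [Px|nPx] := pselect (place_ring P x).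
  have Pz := zint P Px; split=> // _.
  by case: asboolP => // PQ; case: nQx; rewrite -PQ.
rewrite (infinite_place_unique nPx nQx) asboolT //; split=> [_|nnQz].
  exact/(prime_order_valuation it t0 _ (uniformizer_prime nQx) oz).
have /(order_ring it t0 oz) : place_ring Q z by apply: contrapT.
lia.
Qed.

End Uniformizer.
End KummerCurve.

(** * The gap set *)

Lemma ceil_divE (n d : nat) : (0 < d)%N -> ceil_div n%:Z d%:Z = (ceil_divn n d)%:Z.
Proof.
move=> d0; apply: Num.Theory.ceil_def; have := ceil_divnP n d0.
set k := ceil_divn n d => kP.
have dQ : 0 < d%:Z%:~R :> rat by rewrite ltr0z ltz_nat.
by rewrite ltr_pdivlMr // ler_pdivrMr // -!intrM ltr_int ler_int; lia.
Qed.

Theorem proposition4p1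
    (Fq : finFieldType) (p : nat) (hp : p \in [pchar Fq])
    (K : closedFieldType) (iota : {rmorphism Fq -> K})
    (hK : forall a : K, algebraicOver iota a)
    (r : nat) (alpha : 'I_r -> K) (halpha : injective alpha)
    (m : nat) (hm : (0 < m)%N) (hpm : ~~ (p %| m)%N)
    (lambda : 'I_r -> nat) (hlambda : forall i, (1 <= lambda i < m)%N)
    (lambda0 : nat) (hlambda0 : lambda0 = (\sum_(i < r) lambda i)%N)
    (hgcd : gcdn m lambda0 = 1%N)
    (F : fieldExtType {fraction {poly K}}) (x y : F)
    (hx : x = ratfun_ext F (ratfun_X K))
    (hF : <<1; y>>%VS = fullv)
    (hy : y ^+ m = \prod_(i < r) (x - ext_const F (alpha i)) ^+ lambda i)
    (Pinf : place (ratfun_const K)) (hPinf : is_pole Pinf (ratfun_X K))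
    (Qinf : place (ext_const F)) (hQinf : lies_over (ratfun_ext F) Qinf Pinf) :
  [set s%:Z | s in gap_set Qinf] =
  [set n : int | exists i j : int,
     [/\ 1 <= i <= m%:Z - 1,
         ceil_div (i * lambda0%:Z) m%:Z <= j
           <= \sum_(l < r) ceil_div (i * (lambda l)%:Z) m%:Z - 1
       & n = m%:Z * j - i * lambda0%:Z]].
Proof.
have y_m : y ^+ m = poly_ext F (linear_product alpha lambda).
  rewrite hy hx rmorph_prod; apply: eq_bigr => l _.
  by rewrite rmorphXn rmorphB poly_extC.
have m_neq0 : m%:R != 0 :> K.
  by rewrite -(dvdn_pcharf (rmorph_pchar iota hp)).
have nQx : ~ place_ring Qinf (poly_ext F 'X).
  have : place_ideal Qinf (poly_ext F 'X)^-1.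
    apply: hQinf; exists (ratfun_X K)^-1; last exact: fmorphV.
    by apply/place_idealP; right; rewrite invrK.
  case/place_idealP => [/eqP|]; last by rewrite invrK.
  by rewrite invr_eq0 poly_ext_eq0 polyX_eq0.
rewrite hlambda0 in hgcd *.
have [t t0 tP] := uniformizer hm y_m hgcd.
have memH (i : nat) (j : nat) s : (\sum_(l < r) ceil_divn (i * lambda l) m <= j)%N ->
  (s + i * (\sum_(l < r) lambda l) = m * j)%N -> weierstrass_semigroup Qinf s.
  exact: (pole_order_of_shape hm y_m hgcd t0 tP hF nQx).
have Hmem s := pole_order_shape hm y_m hgcd t0 tP hF nQx m_neq0 halpha (s := s).
have sumE (i : nat) : \sum_(l < r) ceil_div (i%:Z * (lambda l)%:Z) m%:Z =
    (\sum_(l < r) ceil_divn (i * lambda l) m)%:Z.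
  rewrite (big_morph Posz PoszD (erefl _)); apply: eq_bigr => l _.
  by rewrite -PoszM ceil_divE.
set S := (\sum_(l < r) lambda l)%N in hgcd tP memH Hmem *.
apply/seteqP; split=> [_ [s nHs <-]|n [i [j [/andP[i1 im] /andP[ceil_j j_sum] nE]]]].
  have [i [j [im sE]]] := residue_exists s hm hgcd.
  exists i%:Z, j%:Z; rewrite sumE -PoszM ceil_divE //.
  have nle : ~~ (\sum_(l < r) ceil_divn (i * lambda l) m <= j)%N.
    by apply/negP => le_j; apply: nHs; apply: memH le_j sE.
  have i0 : (0 < i)%N.
    case: posnP nle => // ->; rewrite big1 // => l _.
    by have := ceil_divnP (0 * lambda l) hm; nia.
  have := ceil_divnP (i * S) hm; set c := ceil_divn (i * S) m => cP.
  have cj : (c < j.+1)%N by rewrite -(ltn_pmul2r hm); lia.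
  by split; lia.
move: i i1 im nE ceil_j j_sum => [i|//] i1 im nE; rewrite sumE -PoszM ceil_divE //.
have := ceil_divnP (i * S) hm; set c := ceil_divn (i * S) m => cP.
move: j nE => [j|j] nE cj j_sum; last by lia.
have mcj : (c * m <= m * j)%N by rewrite mulnC leq_mul2l; lia.
exists (m * j - i * S)%N; last by rewrite nE; lia.
move=> /Hmem[i' [j' [sum_j' sE]]].
have eq_ij : (i%:Z - i'%:Z) * S%:Z = (j%:Z - j'%:Z) * m%:Z by lia.
have ii' : i = i'.
  by apply: (residue_inj hgcd) => //; [lia | rewrite eq_ij dvdz_mull].
have jj' : j = j' by rewrite ii' in eq_ij; nia.
by move: sum_j'; rewrite -ii' -jj'; lia.
Qed.
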